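(* Let $n$ be a positive integer and let $\mathbb{D}_{2n}=\langle a,b\mid a^n=b^2=1,\ b^{-1}ab=a^{-1}\rangle$ be the dihedral group of order $2n$. Let $X$ be a normal subset of $\mathbb{D}_{2n}$ such that the Cayley sum graph $\mathrm{CS}(\mathbb{D}_{2n},X)$ is connected and has a subgroup which is a total perfect code. Then one of the following holds: (a) $X=\{b,ab,a^2b,\dots,a^{n-1}b\}$; (b) $n=2\ell$ is even and $X=b^{\mathbb{D}_{2n}}\cup\{a,a^3,\dots,a^{2\ell-1}\}$; (c) $n=2\ell$ is even and $X=(ab)^{\mathbb{D}_{2n}}\cup\{a,a^3,\dots,a^{2\ell-1}\}$; (d) $n=4k+2$ for a positive integer $k$, and there is an inverse-closed left transversal $Z$ of $\langle a^{2k+1}\rangle$ in $\langle a\rangle$ such that $X=b^{\mathbb{D}_{2n}}\cup(Z\setminus\langle a^{2k+1}\rangle)\cup\{a^{2k+1}\}$ or $X=(ab)^{\mathbb{D}_{2n}}\cup(Z\setminus\langle a^{2k+1}\rangle)\cup\{a^{2k+1}\}$.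
   Context: A subset $X$ of a finite group $G$ is normal if $g^{-1}Xg=X$ for all $g\in G$. The Cayley sum graph $\mathrm{CS}(G,X)$ has vertex set $G$, with distinct vertices $g,h$ adjacent iff $gh\in X$. A total perfect code in a graph is a set $C$ of vertices such that every vertex of the graph has exactly one neighbour in $C$. $g^{G}$ denotes the conjugacy class of $g$; when $n=2\ell$ is even, $b^{\mathbb{D}_{2n}}=\{b,a^2b,\dots,a^{2\ell-2}b\}$ and $(ab)^{\mathbb{D}_{2n}}=\{ab,a^3b,\dots,a^{2\ell-1}b\}$.
   Formalization: The formal theorem additionally assumes that X does not contain 1; without this the claim fails, e.g. for X consisting of 1 and all reflections, with the subgroup {1, b} as total perfect code, since no set in (a)–(d) contains 1. *)

(* Defs.v *)
From mathcomp Require Import all_boot all_fingroup all_solvable.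

Set Implicit Arguments.
Unset Strict Implicit.
Unset Printing Implicit Defensive.

Import GroupScope.

(* The whole group gT is < a, b | a^n = b^2 = 1, b^-1 a b = a^-1 >, with a and b
   the two distinguished generators: they satisfy the relations, and the order
   2n rules out proper quotients (see dihedral_isoGrp). *)
Definition dihedral (gT : finGroupType) (n : nat) (a b : gT) : Prop :=
  [/\ <<[set a; b]>> = [set: gT], a ^+ n = 1, b ^+ 2 = 1, a ^ b = a^-1
    & #|gT| = (2 * n)%N].

Lemma dihedral_isoGrp (gT : finGroupType) (n : nat) (a b : gT) :
  (0 < n)%N -> dihedral n a b ->
  [set: gT] \isog Grp (x : y : x ^+ n, y ^+ 2, x ^ y = x^-1).
Proof.
move=> n_gt0 [genG an b2 ab oG].
have gen_ab : <[a]> <*> <[b]> = [set: gT].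
  by rewrite joing_idl joing_idr; exact: genG.
have homG : [set: gT] \homg Grp (x : y : x ^+ n, y ^+ 2, x ^ y = x^-1).
  by apply/existsP; exists (a, b); rewrite /= an b2 ab gen_ab.
have [n_gt1 | n_le1] := ltnP 1 n.
  have Grp_D := Grp_dihedral n_gt1.
  apply: (isoGrp_trans _ Grp_D).
  rewrite isogEcard (card_dihedral n_gt1) cardsT oG mul2n leqnn.
  by rewrite Grp_D homG.
have n1 : n = 1%N by apply/eqP; rewrite eqn_leq n_le1 n_gt0.
subst n; rewrite expg1 in an; subst a.
have Gb : [set: gT] = <[b]> by rewrite -gen_ab cycle1 joing1G.
apply: intro_isoGrp => // rT H /existsP[[x y]] /=.
rewrite !xpair_eqE /= => /and4P[/eqP defH /eqP x1 /eqP y2 _].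
rewrite expg1 in x1; rewrite {x}x1 in defH.
have Hy : H :=: <[y]> by rewrite -defH cycle1 joing1G.
have ob : #[b] = 2%N by rewrite orderE -Gb cardsT oG.
have dvd_yb : #[y] %| #[b] by rewrite ob order_dvdn y2.
by rewrite Gb; apply/homgP; exists (eltm_morphism dvd_yb); rewrite im_eltm Hy.
Qed.

Definition normal_subset (gT : finGroupType) (X : {set gT}) : Prop :=
  forall g : gT, X :^ g = X.

(* Nothing forces 1 \notin X here, so the classification assumes it explicitly:
   without it, X = 1 |: ~: <[a]>, with the code <[b]>, is an exception in every
   dihedral group. *)
Definition cayley_sum_graph (gT : finGroupType) (X : {set gT}) : rel gT :=
  fun g h => (g != h) && (g * h \in X).

Lemma cayley_sum_graph_sym (gT : finGroupType) (X : {set gT}) :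
  normal_subset X -> symmetric (cayley_sum_graph X).
Proof.
move=> nX g h; rewrite /cayley_sum_graph eq_sym.
have -> : h * g = (g * h) ^ g by rewrite conjgE mulgA mulKg.
by rewrite -{2}(nX g) memJ_conjg.
Qed.

Definition connected_graph (V : finType) (e : rel V) : Prop :=
  forall x y : V, connect e x y.

Definition total_perfect_code (V : finType) (e : rel V) (C : {set V}) : Prop :=
  forall v : V, #|[set c in C | e v c]| = 1%N.

Definition inverse_closed (gT : finGroupType) (Z : {set gT}) : Prop :=
  forall z : gT, z \in Z -> z^-1 \in Z.

Definition left_transversal (gT : finGroupType) (Z : {set gT})
    (H K : {group gT}) : Prop :=
  is_transversal Z (lcosets H K) K.

(* Main.v *)
(** A subgroup H is a total perfect code of CS(G, X) only if X meets every left
    coset of H exactly once; let x be the element of X in H. Write A = <a> and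
    Q = <a^2>, which is the set of squares of A. The class of a reflection r is
    Q r, two nonsquares of A have a square product, and X contains no two
    distinct elements of the same coset.
    - If x is a rotation, then x = x^-1, and X contains a reflection r by
      connectivity. A reflection in H would force, with the help of r and x, a
      second element of X in H; so H <= A. As h r = r h^-1, H contains no
      square other than 1, hence H = {1, x} with x a nonsquare. Then x = a^l
      with n = 2l and l odd, and the reflections of X form one class.
    - If x is a reflection and H contains a rotation c <> 1, then c is a
      nonsquare and X = Q x lies in the proper subgroup Q<x>, against
      connectivity. Otherwise H = {1, x}, and for each rotation g exactly one
      of g and g x is in X, the choice depending only on whether g is in Q. *)

Require Import Defs.
From mathcomp Require Import all_boot all_fingroup all_solvable.

Set Implicit Arguments.
Unset Strict Implicit.
Unset Printing Implicit Defensive.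

Import GroupScope.

(** * Subgroup codes and connectivity in Cayley sum graphs *)

(** Together the clauses say that [X] meets every left coset of [H] exactly once. That adjacent
    vertices be distinct costs nothing: a vertex outside [H] differs from all of [H], and for the
    vertex 1 it follows from [1 \notin X]. *)
Lemma total_perfect_code_subgroup (gT : finGroupType) (X : {set gT})
    (H : {group gT}) :
  1 \notin X -> total_perfect_code (cayley_sum_graph X) H ->
  [/\ forall v, exists2 h, h \in H & v * h \in X
    & {in X &, forall u w, u^-1 * w \in H -> u = w}].
Proof.
move=> X1 codeH.
have [x def_x]: exists x, [set c in H | cayley_sum_graph X 1 c] = [set x].
  by apply/cards1P; rewrite codeH.
have xP h : h \in H -> h \in X -> h = x.
  move=> hH hX; apply/set1P; rewrite -def_x inE hH /cayley_sum_graph mul1g hX.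
  by rewrite andbT; apply: contraNneq X1 => ->.
have /setIdP[xH /andP[_]]: x \in [set c in H | cayley_sum_graph X 1 c].
  by rewrite def_x set11.
rewrite mul1g => xX; split=> [v | u w uX wX uwH].
  have [c def_c]: exists c, [set c in H | cayley_sum_graph X v c] = [set c].
    by apply/cards1P; rewrite codeH.
  have /setIdP[cH /andP[_ vcX]]: c \in [set c in H | cayley_sum_graph X v c].
    by rewrite def_c set11.
  by exists c.
have [uH | u'H] := boolP (u \in H).
  have wH: w \in H by rewrite -(groupMl w (groupVr uH)).
  by rewrite (xP u uH uX) (xP w wH wX).
(* As [u] itself lies in [X], the vertex [u] outside [H] is adjacent to both 1 and [u^-1 * w], which
   therefore coincide. *)
have [c def_c]: exists c, [set c in H | cayley_sum_graph X u c] = [set c].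
  by apply/cards1P; rewrite codeH.
have cP h : h \in H -> u * h \in X -> h = c.
  move=> hH uhX; apply/set1P; rewrite -def_c inE hH /cayley_sum_graph uhX.
  by rewrite andbT; apply: contraNneq u'H => ->.
have uwc: u^-1 * w = c by apply: cP; rewrite ?mulKVg.
have c1: 1 = c by apply: cP; rewrite ?group1 ?mulg1.
by rewrite -(mulKVg u w) uwc -c1 mulg1.
Qed.

(** When [u * v] lies in [K], either both factors do or neither does, so [K] is a union of
    components. *)
Lemma connected_sub_group (gT : finGroupType) (X : {set gT})
    (K : {group gT}) (g : gT) :
  connected_graph (cayley_sum_graph X) -> X \subset K -> g \in K.
Proof.
move=> connX sXK; have clK: closed (cayley_sum_graph X) (mem K).
  move=> u v /andP[_ /(subsetP sXK) uvK].
  by apply/idP/idP => [uK | vK]; rewrite -?(groupMl v uK) -?(groupMr u vK).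
by rewrite -(closed_connect clK (connX 1 g)) group1.
Qed.

(** * Rotations and reflections of the dihedral group *)

Lemma dihedral_mulG (gT : finGroupType) (n : nat) (a b : gT) :
  dihedral n a b -> <[a]> * <[b]> = [set: gT].
Proof.
case=> genG _ _ ab _; have nAb: <[b]> \subset 'N(<[a]>).
  by rewrite cycle_subG; apply/normP; rewrite -cycleJ ab cycleV.
by rewrite -norm_joinEr // joing_idl joing_idr -genG.
Qed.

(** Counting leaves no slack: [2 * n] is at most [#[a] * #[b]], while [#[a] <= n] and [#[b] <=
    2]. *)
Lemma dihedral_order (gT : finGroupType) (n : nat) (a b : gT) :
  (0 < n)%N -> dihedral n a b -> #[a] = n /\ b \notin <[a]>.
Proof.
move=> n_gt0 dG; have GE := dihedral_mulG dG; case: dG => _ an b2 _ oG.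
have le_a: (#[a] <= n)%N by rewrite dvdn_leq // order_dvdn an.
have le_b: (#[b] <= 2)%N by rewrite dvdn_leq // order_dvdn b2.
have le_G: (2 * n <= #[a] * #[b])%N.
  rewrite -oG -cardsT -GE !orderE mul_cardG.
  by rewrite leq_pmulr // cardG_gt0.
split; first apply/eqP.
  rewrite eqn_leq le_a -(leq_pmul2l (isT : 0 < 2)%N) mulnC.
  by rewrite mulnC (leq_trans le_G) // mulnC leq_mul2r le_b orbT.
apply: contraL le_a => bA; rewrite -ltnNge orderE.
have ->: <[a]> = [set: gT] by rewrite -GE mulGSid // cycle_subG.
by rewrite cardsT oG ltn_Pmull.
Qed.

Lemma dihedral_reflectionP (gT : finGroupType) (n : nat) (a b r : gT) :
  dihedral n a b -> r \notin <[a]> -> exists i, r = a ^+ i * b.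
Proof.
move=> dG r'A; have := in_setT r; rewrite -(dihedral_mulG dG).
case: dG => _ _ b2 _ _ /mulsgP[_ _ /cycleP[i ->] /cycleP[j ->] def_r].
exists i; rewrite def_r in r'A *.
rewrite -(odd_double_half j) -mul2n expgD expgM b2 expg1n mulg1 in r'A *.
case: (odd j) r'A => //=.
by rewrite expg0 mulg1 mem_cycle.
Qed.

Lemma dihedral_inv (gT : finGroupType) (n : nat) (a b r c : gT) :
  dihedral n a b -> r \notin <[a]> -> c \in <[a]> -> c ^ r = c^-1.
Proof.
move=> dG /(dihedral_reflectionP dG)[i ->] /cycleP[j ->].
case: dG => _ _ _ ab _.
have ->: (a ^+ j) ^ (a ^+ i * b) = (a ^+ j) ^ b.
  by rewrite conjgM (conjgE (a ^+ j)) -(commuteX2 i j (commute_refl a)) mulKg.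
by rewrite conjXg ab expVgn.
Qed.

Lemma dihedral_reflection_sqr (gT : finGroupType) (n : nat) (a b r : gT) :
  (0 < n)%N -> dihedral n a b -> r \notin <[a]> -> r * r = 1.
Proof.
move=> n_gt0 dG /(dihedral_reflectionP dG)[i ->].
have [_ b'A] := dihedral_order n_gt0 dG.
have := dihedral_inv dG b'A (mem_cycle a i); case: dG => _ _ b2 _ _.
have bb: b^-1 = b by apply/eqP; rewrite eq_invg_mul -[b * b]/(b ^+ 2) b2.
by rewrite conjgE bb -mulgA => ->; rewrite mulgV.
Qed.

Lemma dihedral_refl_mul (gT : finGroupType) (n : nat) (a b r s : gT) :
  (0 < n)%N -> dihedral n a b -> r \notin <[a]> -> s \notin <[a]> ->
  r * s \in <[a]>.
Proof.
move=> n_gt0 dG r'A s'A; have bb := dihedral_reflection_sqr n_gt0 dG.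
have s_inv: s^-1 = s by apply/eqP; rewrite eq_invg_mul bb.
have [i ->] := dihedral_reflectionP dG r'A.
have [j def_s] := dihedral_reflectionP dG s'A.
by rewrite -s_inv def_s invMg mulgA mulgK groupMl ?groupV ?mem_cycle.
Qed.

(** * Squares and nonsquares in a cyclic group *)

Lemma cycle_sqr_oddP (gT : finGroupType) (a c : gT) :
  c \in <[a]> -> c \notin <[a ^+ 2]> -> exists i, c = a ^+ (2 * i + 1)%N.
Proof.
case/cycleP=> j ->; rewrite -{1}(odd_double_half j) -mul2n.
case: (boolP (odd j)) => [jo _ | _].
  by exists j./2; rewrite -{1}(odd_double_half j) jo -mul2n addnC.
by rewrite add0n expgM mem_cycle.
Qed.

Lemma cycle_sqrP (gT : finGroupType) (a q : gT) :
  reflect (exists2 e, e \in <[a]> & q = e * e) (q \in <[a ^+ 2]>).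
Proof.
apply: (iffP (cycleP _ _)) => [[i ->] | [e /cycleP[i ->] ->]].
  by exists (a ^+ i); rewrite ?mem_cycle // -expgD addnn -mul2n expgM.
by exists i; rewrite -expgD addnn -mul2n expgM.
Qed.

Lemma cycle_sqr_sub (gT : finGroupType) (a : gT) : <[a ^+ 2]> \subset <[a]>.
Proof. by rewrite cycle_subG mem_cycle. Qed.

Lemma cycle_sqr_mul (gT : finGroupType) (a c d : gT) :
  c \in <[a]> -> d \in <[a]> -> c \notin <[a ^+ 2]> -> d \notin <[a ^+ 2]> ->
  c * d \in <[a ^+ 2]>.
Proof.
move=> cA dA /(cycle_sqr_oddP cA)[i ->] /(cycle_sqr_oddP dA)[j ->].
by rewrite -expgD addnACA -mulnDr -(mulnDr 2 _ 1%N) expgM mem_cycle.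
Qed.

(** A nonsquare forces even order: it puts [a], hence every odd power of [a], outside [<[a ^+ 2]>],
    whereas odd order would make 1 an odd power. *)
Lemma cycle_sqr_compl (gT : finGroupType) (a c : gT) :
  c \in <[a]> -> c \notin <[a ^+ 2]> ->
  exists2 l, #[a] = (2 * l)%N
    & <[a]> :\: <[a ^+ 2]> = [set a ^+ (2 * i + 1)%N | i : 'I_l].
Proof.
move=> cA c'Q.
have a'Q: a \notin <[a ^+ 2]>.
  by apply: contra c'Q => aQ; apply: subsetP cA; rewrite cycle_subG.
have odd'Q i : a ^+ (2 * i + 1)%N \notin <[a ^+ 2]>.
  by rewrite expgD expgM groupMl ?mem_cycle.
have oa: #[a] = (2 * #[a]./2)%N.
  rewrite -{1}(odd_double_half #[a]) -mul2n.
  case: (boolP (odd #[a])) => // ao; case/negP: (odd'Q #[a]./2).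
  have ->: (2 * #[a]./2 + 1)%N = #[a].
    by rewrite -{2}(odd_double_half #[a]) ao mul2n addnC.
  by rewrite expg_order group1.
exists #[a]./2 => //; apply/setP=> g; apply/setDP/imsetP => [[gA g'Q] | [i _ ->]].
  have [i def_g] := cycle_sqr_oddP gA g'Q.
  have l_gt0: (0 < #[a]./2)%N by case: #[a]./2 oa (order_gt0 a) => // ->.
  exists (Ordinal (ltn_pmod i l_gt0)) => //=.
  rewrite def_g {1}(divn_eq i #[a]./2) mulnDr mulnCA -oa -addnA expgD mulnC expgM.
  by rewrite expg_order expg1n mul1g.
by split; rewrite ?mem_cycle.
Qed.

(** * Conjugacy classes of reflections *)

Lemma dihedral_refl_comm (gT : finGroupType) (n : nat) (a b r c : gT) :
  dihedral n a b -> r \notin <[a]> -> c \in <[a]> -> c * r = r * c^-1.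
Proof. by move=> dG r'A cA; rewrite -(dihedral_inv dG r'A cA) conjgE mulKVg. Qed.

Lemma dihedral_refl_class (gT : finGroupType) (n : nat) (a b r : gT) :
  (0 < n)%N -> dihedral n a b -> r \notin <[a]> ->
  r ^: [set: gT] = <[a ^+ 2]> :* r.
Proof.
move=> n_gt0 dG r'A; have rr := dihedral_reflection_sqr n_gt0 dG r'A.
have rJ e : e \in <[a]> -> r ^ e^-1 = e * e * r.
  move=> eA; rewrite conjgE invgK -mulgA.
  by rewrite -(dihedral_refl_comm dG r'A eA) mulgA.
apply/setP=> y; apply/imsetP/rcosetP => [[g _ ->] | [q /cycle_sqrP[e eA ->] ->]].
  have [gA | g'A] := boolP (g \in <[a]>).
    exists (g^-1 * g^-1); last by rewrite -[g in LHS]invgK rJ ?groupV.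
    by apply/cycle_sqrP; exists g^-1; rewrite ?groupV.
  (* A reflection [g] conjugates [r] to [g * r * g], which is [d * d * r] for the rotation
     [d = g * r]. *)
  have dA := dihedral_refl_mul n_gt0 dG g'A r'A; set d := g * r in dA.
  exists (d * d); first by apply/cycle_sqrP; exists d.
  rewrite -rJ // !conjgE !invgK !invMg /d -!mulgA.
  have rI: r^-1 = r by apply/eqP; rewrite eq_invg_mul rr.
  have gI: g^-1 = g.
    by apply/eqP; rewrite eq_invg_mul (dihedral_reflection_sqr n_gt0 dG g'A).
  by rewrite rI gI (mulgA r r) rr mul1g.
by exists e^-1; rewrite ?inE // rJ.
Qed.

Lemma dihedral_refl_classE (gT : finGroupType) (n : nat) (a b r : gT) :
  (0 < n)%N -> dihedral n a b -> r \notin <[a]> ->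
  <[a ^+ 2]> :* r = b ^: [set: gT] \/ <[a ^+ 2]> :* r = (a * b) ^: [set: gT].
Proof.
move=> n_gt0 dG r'A; have [_ b'A] := dihedral_order n_gt0 dG.
have ab'A: a * b \notin <[a]> by rewrite groupMl ?cycle_id.
rewrite (dihedral_refl_class n_gt0 dG b'A) (dihedral_refl_class n_gt0 dG ab'A).
have [i ->] := dihedral_reflectionP dG r'A.
have [iQ | i'Q] := boolP (a ^+ i \in <[a ^+ 2]>); [left | right].
  by rewrite rcosetM rcoset_id.
have [j ->] := cycle_sqr_oddP (mem_cycle a i) i'Q.
by rewrite expgD expg1 -mulgA (rcosetM _ (a ^+ _)) expgM rcoset_id ?mem_cycle.
Qed.

(** * Consequences of the coset condition *)

Section SubgroupCode.

Variables (gT : finGroupType) (n : nat) (a b : gT) (X : {set gT}).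
Variable H : {group gT}.

Hypothesis n_gt0 : (0 < n)%N.
Hypothesis dG : dihedral n a b.
Hypothesis nX : normal_subset X.
Hypothesis X1 : 1 \notin X.
Hypothesis connX : connected_graph (cayley_sum_graph X).
Hypothesis tr_ex : forall v, exists2 h, h \in H & v * h \in X.
Hypothesis tr_uniq : {in X &, forall u w, u^-1 * w \in H -> u = w}.

Local Notation A := <[a]>.
Local Notation Q := <[a ^+ 2]>.

Let b'A : b \notin A. Proof. by case: (dihedral_order n_gt0 dG). Qed.

Let rr r : r \notin A -> r * r = 1.
Proof. exact: dihedral_reflection_sqr n_gt0 dG. Qed.

Let refl_comm r c : r \notin A -> c \in A -> c * r = r * c^-1.
Proof. exact: dihedral_refl_comm dG. Qed.

Let sQA q : q \in Q -> q \in A. Proof. exact/subsetP/cycle_sqr_sub. Qed.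

Lemma normal_refl_class r q : r \in X -> r \notin A -> q \in Q -> q * r \in X.
Proof.
move=> rX r'A qQ; have: q * r \in r ^: [set: gT].
  by rewrite (dihedral_refl_class n_gt0 dG) // mem_rcoset mulgK.
by case/imsetP=> g _ ->; rewrite -(nX g) memJ_conjg.
Qed.

Lemma normal_rot_inv x : x \in X -> x \in A -> x^-1 \in X.
Proof. by move=> xX xA; rewrite -(dihedral_inv dG b'A xA) -(nX b) memJ_conjg. Qed.

Lemma transversal_mul u h : u \in X -> h \in H -> u * h \in X -> h = 1.
Proof.
move=> uX hH uhX; have uE: u = u * h by apply: tr_uniq; rewrite ?mulKg.
by rewrite -(mulKg u h) -uE mulVg.
Qed.

(** By normality [x^-1], the conjugate of [x] by [b], is also in [X], and it shares the coset [H]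
    with [x]. *)
Lemma code_rot_sqr x : x \in X -> x \in H -> x \in A -> x * x = 1.
Proof.
move=> xX xH xA.
have: x^-1 * x^-1 = 1.
  apply: (transversal_mul xX); rewrite ?groupM ?groupV //.
  by rewrite mulKVg normal_rot_inv.
by move/(congr1 invg); rewrite invMg invgK invg1.
Qed.

Lemma refl_split s r : s \notin A -> r \notin A -> s * r \in A /\ s = s * r * r.
Proof.
move=> s'A r'A; split; first exact: dihedral_refl_mul n_gt0 dG s'A r'A.
by rewrite -mulgA rr ?mulg1.
Qed.

Lemma all_reflections x :
  x \notin A -> (forall g, g \in A -> g * x \in X) ->
  (forall g, g \in A -> g \notin X) ->
  X = [set a ^+ (i : nat) * b | i : 'I_n].
Proof.
move=> x'A AxX A'X; apply/setP=> g; apply/idP/imsetP => [gX | [i _ ->]].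
  have g'A: g \notin A by apply: contraL gX => /A'X.
  have [gbA ->] := refl_split g'A b'A.
  have [i lt_i ->] := cyclePmin gbA.
  have [oa _] := dihedral_order n_gt0 dG; rewrite oa in lt_i.
  by exists (Ordinal lt_i).
have ab'A: a ^+ i * b \notin A by rewrite groupMl ?mem_cycle.
by have [abA ->] := refl_split ab'A x'A; apply: AxX.
Qed.

Lemma half_reflections x c :
  x \notin A -> c \in A -> c \notin Q -> X = Q :* x :|: (A :\: Q) ->
  (exists2 l : nat, n = (2 * l)%N
     & X = b ^: [set: gT] :|: [set a ^+ (2 * i + 1)%N | i : 'I_l]) \/
  (exists2 l : nat, n = (2 * l)%N
     & X = (a * b) ^: [set: gT] :|: [set a ^+ (2 * i + 1)%N | i : 'I_l]).
Proof.
move=> x'A cA c'Q ->; have [l oa ->] := cycle_sqr_compl cA c'Q.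
have [<- _] := dihedral_order n_gt0 dG.
by case: (dihedral_refl_classE n_gt0 dG x'A) => ->; [left | right]; exists l.
Qed.

(** * The element of [X] in [H] is a rotation *)

Lemma code_rot_sub x y :
  x \in X -> x \in H -> x \in A -> y \in H -> y \in A.
Proof.
move=> xX xH xA yH; apply/negPn/negP => y'A.
have xx := code_rot_sqr xX xH xA.
have xI: x^-1 = x by apply/eqP; rewrite eq_invg_mul xx.
have [r rX r'A]: exists2 r, r \in X & r \notin A.
  apply/subsetPn; apply: contra b'A => sXA.
  exact: connected_sub_group connX sXA.
have [cA def_y] := refl_split y'A r'A; set c := y * r in cA def_y.
have c'Q: c \notin Q.
  apply: contra y'A => cQ; have yX: y \in X by rewrite def_y normal_refl_class.
  by rewrite -(tr_uniq xX yX) // groupM ?groupV.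
(* For a square [x], the element [x * r = r * x] of [X] would share a coset with [r], giving
   [x = 1]. *)
have x'Q: x \notin Q.
  apply: contra X1 => xQ; have:= normal_refl_class rX r'A xQ.
  by rewrite refl_comm // xI => /(transversal_mul rX xH) <-.
(* Now [x * c] is a square, so [x * y] is an element of [X] in the coset of [x]. *)
have: x * c * r \in X by apply: normal_refl_class => //; apply: cycle_sqr_mul.
rewrite -mulgA -def_y => /(transversal_mul xX yH) y1.
by rewrite y1 group1 in y'A.
Qed.

Lemma code_rot x :
  x \in X -> x \in H -> x \in A ->
  [\/ exists2 l : nat, n = (2 * l)%N
        & X = b ^: [set: gT] :|: [set a ^+ (2 * i + 1)%N | i : 'I_l],
      exists2 l : nat, n = (2 * l)%N
        & X = (a * b) ^: [set: gT] :|: [set a ^+ (2 * i + 1)%N | i : 'I_l]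
    | exists k : nat,
        [/\ (0 < k)%N, n = (4 * k + 2)%N
          & exists Z : {set gT},
              [/\ inverse_closed Z,
                  left_transversal Z <[a ^+ (2 * k + 1)%N]> <[a]>
                & X = b ^: [set: gT] :|: (Z :\: <[a ^+ (2 * k + 1)%N]>)
                        :|: [set a ^+ (2 * k + 1)%N]
                  \/ X = (a * b) ^: [set: gT] :|: (Z :\: <[a ^+ (2 * k + 1)%N]>)
                        :|: [set a ^+ (2 * k + 1)%N]]]].
Proof.
move=> xX xH xA; have sHA h : h \in H -> h \in A by apply: code_rot_sub xX xH xA.
have xx := code_rot_sqr xX xH xA.
have xI: x^-1 = x by apply/eqP; rewrite eq_invg_mul xx.
have x_neq1: x <> 1 by move=> x1; case/negP: X1; rewrite -x1.
have [r rX r'A]: exists2 r, r \in X & r \notin A.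
  have [h hH bhX] := tr_ex b; exists (b * h) => //.
  rewrite (groupMr _ (sHA h hH)). exact: b'A.
have HQ1 h : h \in H -> h \in Q -> h = 1.
  move=> hH hQ; have:= normal_refl_class rX r'A hQ.
  rewrite (refl_comm r'A (sQA hQ)) => /(transversal_mul rX (groupVr hH)) hV.
  by rewrite -[h]invgK hV invg1.
have x'Q: x \notin Q by apply/negP => /(HQ1 x xH).
have Hx h : h \in H -> h = 1 \/ h = x.
  move=> hH; have [/(HQ1 h hH) | h'Q] := boolP (h \in Q); [by left | right].
  have: x * h = 1 by apply: HQ1; [rewrite groupM | apply: cycle_sqr_mul; rewrite ?sHA].
  by move/(congr1 (mulg x)); rewrite mulgA xx mul1g mulg1.
have HE: H = <[x]>%G.
  apply/val_inj/eqP; rewrite eqEsubset cycle_subG xH andbT.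
  by apply/subsetP=> h /Hx[] ->; rewrite ?group1 ?cycle_id.
have Xr s : (s \in X) && (s \notin A) = (s \in Q :* r).
  apply/andP/rcosetP => [[sX s'A] | [q qQ ->]]; last first.
    by rewrite normal_refl_class // groupMl // sQA.
  have [cA def_s] := refl_split s'A r'A; exists (s * r) => //.
  (* For a nonsquare [s * r], the product [s * x = x * (s * r) * r] would be in [X] and in the coset
     of [s]. *)
  apply/negPn/negP => c'Q; apply: x_neq1; apply: (transversal_mul sX xH).
  have ->: s * x = x * s by rewrite (refl_comm s'A xA) xI.
  rewrite def_s mulgA normal_refl_class //.
  exact: cycle_sqr_mul.
have [oa _] := dihedral_order n_gt0 dG.
have [l ol AQ] := cycle_sqr_compl xA x'Q.
have: x \in A :\: Q by rewrite inE x'Q.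
rewrite AQ => /imsetP[[k lt_kl] _ /= def_x].
(* From [x * x = 1], [l] divides [2 * k + 1]; since [k < l], the quotient can only be 1. *)
have def_l: l = (2 * k + 1)%N.
  have: (#[a] %| 2 * (2 * k + 1))%N by rewrite order_dvdn mulnC expgM -def_x -xx.
  rewrite ol dvdn_pmul2l // => /dvdnP[[|[|m]]]; rewrite ?mul1n ?addn1 //.
  have: (2 * k.+1 <= 2 * l)%N by rewrite leq_mul2l.
  by rewrite mulnS add2n => + def_k; rewrite def_k ltnNge leq_mul2r orbT.
(* For [k = 0] the group has order 4 and [Q] is trivial; this falls under the first two cases, as
   the third asks for positive [k]. *)
have [k0 | k_gt0] := posnP k.
  have Q1: Q = 1 by apply/eqP; rewrite cycle_eq1 -order_dvdn ol def_l k0.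
  have: X = Q :* r :|: (A :\: Q).
    apply/setP=> g; rewrite !inE -Xr; have [gA | g'A] := boolP (g \in A); last first.
      by rewrite andbT andbF orbF.
    rewrite andbF andbT /=; apply/idP/idP => [gX | g'Q].
      by apply: contraNN X1; rewrite Q1 => /set1P <-.
    have: g \in A :\: Q by rewrite inE g'Q.
    rewrite AQ => /imsetP[[i lt_i] _ ->] /=.
    have ->: i = k by move: lt_i; rewrite def_l k0 ltnS leqn0 => /eqP.
    by rewrite -def_x.
  by case/(half_reflections r'A xA x'Q) => ?; [apply: Or31 | apply: Or32].
apply: Or33; exists k; split=> //.
  by rewrite -oa ol def_l mulnDr mulnA.
(* The witness is the rotation part of [X]: as [H = <[x]>] lies in [A], the element of [X] in a
   coset of [H] inside [A] is a rotation. Removing [<[x]>] loses only [x], which is added back. *)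
rewrite -def_x; exists (X :&: A); split.
- by move=> z /setIP[zX zA]; rewrite inE normal_rot_inv // groupV.
- rewrite /left_transversal /is_transversal -HE.
  apply/and3P; split; first 1 last.
  + exact: subsetIr.
  + apply/forall_inP => _ /imsetP[g gA ->]; rewrite lcosetE.
    have [h hH ghX] := tr_ex g; apply/cards1P; exists (g * h).
    apply/setP=> w; rewrite !in_setI in_set1 mem_lcoset.
    apply/idP/eqP => [/andP[/andP[wX wA] wg] | ->].
      by apply: esym; apply: tr_uniq => //; rewrite invMg -mulgA groupM ?groupV.
    by rewrite ghX mulKg hH groupM ?(sHA h).
  + have ->: lcosets H A = rcosets H A.
      apply: eq_in_imset => g gA; rewrite lcosetE rcosetE norm_rlcoset //.
      apply: subsetP gA; apply/cents_norm/(sub_abelian_cent (cycle_abelian a)).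
      exact/subsetP.
    by apply: rcosets_partition; apply/subsetP.
have defX: X = Q :* r :|: (X :&: A :\: <[x]>) :|: [set x].
  have ->: <[x]> = H :> {set gT} by rewrite HE.
  apply/setP=> g; rewrite !in_setU in_setD in_setI in_set1 -Xr.
  have [gX | g'X] /= := boolP (g \in X); last first.
    by rewrite andbF; apply/esym/negbTE; apply: contraNneq g'X => ->.
  have [gA | g'A] //= := boolP (g \in A); rewrite andbT.
  have [gH | //] := boolP (g \in H).
  case: (Hx g gH) => def_g; last by rewrite def_g eqxx.
  by case/negP: X1; rewrite -def_g.
by case: (dihedral_refl_classE n_gt0 dG r'A) => <-; [left | right].
Qed.

(** * The element of [X] in [H] is a reflection *)

Lemma code_refl_rot1 x c :
  x \in X -> x \in H -> x \notin A -> c \in H -> c \in A -> c = 1.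
Proof.
move=> xX xH x'A cH cA; apply/eqP/negPn/negP => c_neq1.
(* The product [c * s = s * c^-1] stays in the coset of [s]. *)
have commH s : s \in X -> s \notin A -> c * s \notin X.
  move=> sX s'A; apply: contra c_neq1 => csX; rewrite -eq_invg1; apply/eqP.
  by apply: (transversal_mul sX); rewrite ?groupV // -refl_comm.
have c'Q: c \notin Q by apply: contra (commH x xX x'A); apply: normal_refl_class.
have sXK: X \subset Q <*> <[x]>.
  apply/subsetP=> s sX; have [sA | s'A] := boolP (s \in A).
    have [sQ | s'Q] := boolP (s \in Q); first by rewrite mem_gen // inE sQ.
    (* Here [s * c] is a square, so [s * (c * x)] would be a second element of [X] in the coset of
       [s]. *)
    have: s * c * x \in X by apply: normal_refl_class => //; apply: cycle_sqr_mul.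
    rewrite -mulgA => /(transversal_mul sX (groupM cH xH)) cx1.
    by case/negP: x'A; rewrite -(groupMl x cA) cx1 group1.
  have [gA def_s] := refl_split s'A x'A; rewrite def_s.
  have [gQ | g'Q] := boolP (s * x \in Q).
    by rewrite groupM // mem_gen // inE ?gQ // cycle_id orbT.
  case/negP: (commH s sX s'A).
  by rewrite def_s mulgA normal_refl_class // cycle_sqr_mul.
(* Connectivity would put [c] in [Q * <[x]>], whose rotations all lie in [Q]. *)
have:= connected_sub_group c connX sXK.
rewrite /= norm_joinEr; last first.
  rewrite cycle_subG; apply/normP; rewrite -cycleJ.
  by rewrite (dihedral_inv dG x'A) ?mem_cycle // cycleV.
case/mulsgP=> q _ qQ /cycleP[i ->].
rewrite -(odd_double_half i) -mul2n expgD expgM -[x ^+ 2]/(x * x) rr //.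
rewrite expg1n mulg1; case: (odd i) => /= def_c.
  by case/negP: x'A; rewrite -(groupMl x (sQA qQ)) -[x]expg1 -def_c.
by case/negP: c'Q; rewrite def_c expg0 mulg1.
Qed.

Lemma code_refl x :
  x \in X -> x \in H -> x \notin A ->
  [\/ X = [set a ^+ (i : nat) * b | i : 'I_n],
      exists2 l : nat, n = (2 * l)%N
        & X = b ^: [set: gT] :|: [set a ^+ (2 * i + 1)%N | i : 'I_l]
    | exists2 l : nat, n = (2 * l)%N
        & X = (a * b) ^: [set: gT] :|: [set a ^+ (2 * i + 1)%N | i : 'I_l]].
Proof.
move=> xX xH x'A; have HA1 c := @code_refl_rot1 x c xX xH x'A.
have Hx h : h \in H -> h = 1 \/ h = x.
  move=> hH; have [/(HA1 h hH) | h'A] := boolP (h \in A); [by left | right].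
  have [hxA ->] := refl_split h'A x'A.
  by rewrite (HA1 (h * x)) ?mul1g // groupM.
(* As [H] is [{1, x}], exactly one of [g] and [g * x] is in [X]. *)
have X'x g : g \in X -> g * x \notin X.
  by move=> gX; apply: contra x'A => /(transversal_mul gX xH) ->.
have Xx g : g * x \notin X -> g \in X.
  by have [h /Hx[] -> ] := tr_ex g; rewrite ?mulg1 // => ->.
have QxX q : q \in Q -> q * x \in X by apply: normal_refl_class.
have [/forall_inP AxX | ] := boolP [forall g in A, g * x \in X].
  apply: Or31; apply: (all_reflections x'A) => // g gA.
  by apply: contraL (AxX g gA); apply: X'x.
rewrite negb_forall_in => /exists_inP[c cA c'X].
have c'Q: c \notin Q by apply: contra c'X; apply: QxX.
(* One missing [c * x] excludes the whole other class: [c * x] is the square [c * g^-1] times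
   [g * x]. *)
have Ax'X g : g \in A -> g \notin Q -> g * x \notin X.
  move=> gA g'Q; apply: contra c'X => gxX.
  have ->: c * x = c * g^-1 * (g * x) by rewrite mulgA mulgKV.
  have gx'A: g * x \notin A by rewrite groupMl.
  by rewrite normal_refl_class // cycle_sqr_mul ?groupV.
have: X = Q :* x :|: (A :\: Q).
  apply/setP=> s; rewrite in_setU in_setD mem_rcoset.
  have [sA | s'A] := boolP (s \in A).
    rewrite andbT; have -> : s * x^-1 \in Q = false.
      by apply/negP => /sQA; rewrite groupMl // groupV; apply/negP.
    apply/idP/idP => [/X'x | /(Ax'X s sA)/Xx //].
    by apply: contra; apply: QxX.
  have xI: x^-1 = x by apply/eqP; rewrite eq_invg_mul rr.
  have [sxA def_s] := refl_split s'A x'A; rewrite andbF orbF xI.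
  apply/idP/idP => [| /QxX]; last by rewrite -def_s.
  by rewrite {1}def_s; apply: contraLR; apply: Ax'X.
by case/(half_reflections x'A cA c'Q) => ?; [apply: Or32 | apply: Or33].
Qed.

End SubgroupCode.

Theorem theorem5p10 (gT : finGroupType) (n : nat) (a b : gT) (X : {set gT}) :
  (0 < n)%N ->
  dihedral n a b ->
  normal_subset X ->
  1 \notin X ->
  connected_graph (cayley_sum_graph X) ->
  (exists H : {group gT}, total_perfect_code (cayley_sum_graph X) H) ->
  [\/ X = [set a ^+ (i : nat) * b | i : 'I_n],
      exists2 l : nat, n = (2 * l)%N
        & X = b ^: [set: gT] :|: [set a ^+ (2 * i + 1)%N | i : 'I_l],
      exists2 l : nat, n = (2 * l)%N
        & X = (a * b) ^: [set: gT] :|: [set a ^+ (2 * i + 1)%N | i : 'I_l]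
    | exists k : nat,
        [/\ (0 < k)%N, n = (4 * k + 2)%N
          & exists Z : {set gT},
              [/\ inverse_closed Z,
                  left_transversal Z <[a ^+ (2 * k + 1)%N]> <[a]>
                & X = b ^: [set: gT] :|: (Z :\: <[a ^+ (2 * k + 1)%N]>)
                        :|: [set a ^+ (2 * k + 1)%N]
                  \/ X = (a * b) ^: [set: gT] :|: (Z :\: <[a ^+ (2 * k + 1)%N]>)
                        :|: [set a ^+ (2 * k + 1)%N]]]].
Proof.
move=> n_gt0 dG nX X1 connX [H codeH].
have [tr_ex tr_uniq] := total_perfect_code_subgroup X1 codeH.
(* The coset [H] itself supplies the [x] whose type decides the cases. *)
have [x xH] := tr_ex 1; rewrite mul1g => xX.
have [xA | x'A] := boolP (x \in <[a]>).
  have [?|?|?] := code_rot n_gt0 dG nX X1 connX tr_ex tr_uniq xX xH xA.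
  - exact: Or42.
  - exact: Or43.
  - exact: Or44.
have [?|?|?] := code_refl n_gt0 dG nX connX tr_ex tr_uniq xX xH x'A.
- exact: Or41.
- exact: Or42.
- exact: Or43.
Qed.
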